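(* Let $R$ be a finite commutative Frobenius ring of characteristic $2$, and let $p$ be a prime with $p=4k+1$ for an integer $k$. For $i\in\{0,1,2\}$ let $a_i,b_i,c_i\in R$, let $Q_i=Q_p(a_i,b_i,c_i)$, and let $A_i$ be a $p\times p$ circulant matrix over $R$. Let $\mathcal{C}$ be the linear code of length $6p$ over $R$ generated by the rows of $$M=\left(\begin{array}{ccc|ccc} Q_0&Q_1&Q_2&A_0&A_1&A_2\\ Q_2&Q_0&Q_1&A_2&A_0&A_1\\ Q_1&Q_2&Q_0&A_1&A_2&A_0\end{array}\right).$$ Then $\mathcal{C}$ is self-orthogonal if and only if the following two conditions hold: (1) $$\sum_{i=0}^2 A_iA_i^T=Q_p\left(\sum_{i=0}^2 a_i^2,\ \sum_{i=0}^2\bigl(b_i^2+k(b_i^2+c_i^2)\bigr),\ \sum_{i=0}^2\bigl(c_i^2+k(b_i^2+c_i^2)\bigr)\right);$$ (2) $$\sum_{i=0}^{2}A_iA_{[i+2]_3}^T=Q_p(\alpha,\beta,\gamma),$$ where $$\alpha=\sum_{i=0}^2 a_ia_{[i+2]_3},$$ $$\beta=\sum_{i=0}^2\Bigl(a_ib_{[i+2]_3}+b_ia_{[i+2]_3}+(k+1)b_ib_{[i+2]_3}+k\bigl(b_ic_{[i+2]_3}+c_ib_{[i+2]_3}\bigr)+kc_ic_{[i+2]_3}\Bigr),$$ $$\gamma=\sum_{i=0}^2\Bigl(a_ic_{[i+2]_3}+c_ia_{[i+2]_3}+kb_ib_{[i+2]_3}+k\bigl(b_ic_{[i+2]_3}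+c_ib_{[i+2]_3}\bigr)+(k+1)c_ic_{[i+2]_3}\Bigr).$$
   Context: For $a,b,c\in R$ and a prime $p$, $Q_p(a,b,c)$ is the $p\times p$ circulant matrix (each row is the right cyclic shift by one position of the row above it) whose first row $(r_0,r_1,\dots,r_{p-1})$ is given by $r_0=a$; $r_i=b$ if $i\neq 0$ is a quadratic residue modulo $p$; $r_i=c$ if $i$ is a quadratic non-residue modulo $p$. The notation $[m]_3$ denotes the residue of $m$ modulo $3$ in $\{0,1,2\}$. A code of length $n$ over $R$ is an $R$-submodule of $R^n$; its dual is $\mathcal{C}^\perp=\{x\in R^n : \sum_i x_iy_i=0 \text{ for all } y\in \mathcal{C}\}$ (Euclidean inner product). $\mathcal{C}$ is self-orthogonal if $\mathcal{C}\subseteq \mathcal{C}^\perp$. *)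

(* Defs.v *)
From HB Require Import structures.
From mathcomp Require Import all_boot all_algebra.

Set Implicit Arguments.
Unset Strict Implicit.
Unset Printing Implicit Defensive.

Import GRing.Theory.
Local Open Scope ring_scope.

Section Frobenius.
Variable R : finComNzRingType.

(* Boolean form of GRing.submod_closed on R^o. *)
Definition is_ideal (I : {set R}) : bool :=
  (0 \in I) &&
  [forall a, forall x in I, forall y in I, a * x + y \in I].

Definition maximal_ideal (I : {set R}) : bool :=
  maxset (fun J : {set R} => is_ideal J && (J != [set: R])) I.

Definition minimal_ideal (I : {set R}) : bool :=
  minset (fun J : {set R} => is_ideal J && (J != [set 0])) I.

Definition jacobson : {set R} := \bigcap_(I | maximal_ideal I) I.

(* The sum of the minimal ideals, i.e. the least ideal containing all of
   them. *)
Definition socle : {set R} :=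
  \bigcap_(I | is_ideal I &&
               [forall J : {set R}, minimal_ideal J ==> (J \subset I)]) I.

(* R / J(R) is isomorphic to Soc(R) as an R-module.  The isomorphism is given
   by the R-linear map f on R that induces it: f has kernel J(R) and image
   Soc(R). *)
Definition is_frobenius : Prop :=
  exists f : {linear R^o -> R^o},
    [set x : R | f x == 0] = jacobson /\ [set f x | x : R] = socle.

End Frobenius.

Section Circulant.
Variables (R : nzRingType) (p : nat).

(* The first row is r 0, ..., r (p - 1); row i is its right cyclic shift by i
   positions, so that entry (i, j) is r ((j - i) mod p). *)
Definition circulant_mx (r : nat -> R) : 'M[R]_p :=
  \matrix_(i, j) r ((j + (p - i)) %% p)%N.

Definition is_circulant (A : 'M[R]_p) : Prop :=
  exists r : nat -> R, A = circulant_mx r.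

(* Only used for m not divisible by p. *)
Definition quad_residue (m : nat) : bool :=
  [exists x : 'I_p, (x ^ 2 == m %[mod p])%N].

Definition Qp (a b c : R) : 'M[R]_p :=
  circulant_mx (fun i => if i == 0%N then a
                         else if quad_residue i then b else c).

Definition block_circulant3 (X : 'I_3 -> 'M[R]_p) :
    'M[R]_(p + p + p, p + p + p) :=
  col_mx (col_mx (row_mx (row_mx (X 0) (X 1)) (X 2))
                 (row_mx (row_mx (X 2) (X 0)) (X 1)))
         (row_mx (row_mx (X 1) (X 2)) (X 0)).

End Circulant.

Definition res3 (m : nat) : 'I_3 := inZp m.

Section Codes.
Variables (R : finComNzRingType) (m n : nat).

Definition row_code (M : 'M[R]_(m, n)) : {set 'rV[R]_n} :=
  [set u *m M | u : 'rV[R]_m].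

Definition dual_code (C : {set 'rV[R]_n}) : {set 'rV[R]_n} :=
  [set x : 'rV[R]_n | [forall y in C, \sum_(i < n) x 0 i * y 0 i == 0]].

Definition self_orthogonal (C : {set 'rV[R]_n}) : bool :=
  C \subset dual_code C.

End Codes.

(* Main.v *)
Require Import Defs.
From HB Require Import structures.
From mathcomp Require Import all_boot all_algebra finfield zify ring.

Set Implicit Arguments.
Unset Strict Implicit.
Unset Printing Implicit Defensive.

Import GRing.Theory.
Local Open Scope ring_scope.

(** A code with generator matrix M is self-orthogonal exactly when
    M M^T = 0.  For a matrix made of 3 x 3 circulant blocks X_0, X_1, X_2, the
    product with its transpose is again block circulant: its blocks are the
    cyclic correlations C_s(X) = sum_i X_i X_(i-s)^T, with indices modulo 3
    ([block_circulant3_mul_tr]).  Since M = (B(Q) | B(A)), the code is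
    self-orthogonal iff C_s(Q) + C_s(A) = 0 for s = 0, 1, 2, and the case
    s = 2 is the transpose of the case s = 1.  In characteristic 2 what is left
    is C_0(A) = C_0(Q) and C_1(A) = C_1(Q), which become the two conditions
    once the products Q_i Q_j^T are known.

    Such a product is a correlation over F_p of functions that are constant on
    0, on the nonzero squares and on the non-squares.  Its values are governed
    by the cyclotomic numbers of order 2, i.e. by how often x and x + d
    lie in prescribed quadratic classes.  For a field of 4k + 1 elements these
    numbers are k - 1 when both classes are that of d, and k otherwise
    ([cyclotomicE]), which yields the product formula [Qp_mul_tr] over every
    commutative ring; reducing its coefficients modulo 2 gives those of
    the two conditions. *)

(** * Quadratic classes of a field with 4k + 1 elements *)

Section Cyclotomic.
Variables (F : finFieldType) (k : nat).
Hypothesis cardF : #|F| = (4 * k + 1)%N.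

(** Indexing squares and non-squares by a boolean lets each counting identity be
    stated once for both classes. *)
Definition quad_class (e : bool) : {set F} :=
  [set x | (x != 0) && ([exists y, y ^+ 2 == x] == e)].

Lemma k_gt0 : (0 < k)%N.
Proof. by have := finRing_gt1 F; rewrite cardF; case: (k). Qed.

Lemma expf_order (x : F) : x != 0 -> x ^+ (4 * k) = 1.
Proof.
move=> x0; apply: (mulIf x0).
by rewrite mul1r -exprSr -addn1 -cardF expf_card.
Qed.

Lemma card_neq0 : #|[set x : F | x != 0]| = (4 * k)%N.
Proof.
have -> : [set x : F | x != 0] = [set: F] :\ 0.
  by apply/setP => x; rewrite !inE andbT.
have := cardsD1 (0 : F) [set: F].
by rewrite inE cardsT cardF add1n addn1 => -[<-].
Qed.

(** Squaring is at most two-to-one on the 4k nonzero elements. *)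
Lemma card_squares_ge : (2 * k <= #|quad_class true|)%N.
Proof.
suff: (#|[set x : F | x != 0%R]| <= #|quad_class true| * 2)%N.
  by rewrite card_neq0; lia.
rewrite -sum1_card -sum_nat_const.
rewrite (partition_big (fun x : F => x ^+ 2) (mem (quad_class true))) /=; last first.
  move=> x; rewrite !inE sqrf_eq0 => -> /=.
  by rewrite eqb_id; apply/existsP; exists x.
apply: leq_sum => s; rewrite inE eqb_id => /andP[_ /existsP[y /eqP ys]].
rewrite sum1_card; apply: leq_trans (_ : #|[set y; - y]| <= 2)%N.
  apply: subset_leq_card; apply/subsetP => x; rewrite !inE => /andP[_].
  by rewrite -ys eqf_sqr.
by rewrite cards2; case: (_ != _).
Qed.

(** Squares are roots of X^(2k) - 1, which has at most 2k roots, and there are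
    at least 2k squares; so they are all its roots. *)
Lemma euler_criterion (x : F) :
  (x \in quad_class true) = (x ^+ (2 * k) == 1).
Proof.
pose U := [set x : F | x ^+ (2 * k) == 1].
have k2 : (0 < 2 * k)%N by rewrite muln_gt0 k_gt0.
suff /eqP/setP/(_ x) : quad_class true == U by rewrite [in RHS]inE.
rewrite eqEcard; apply/andP; split.
  apply/subsetP => {}x; rewrite !inE eqb_id => /andP[x0 /existsP[y /eqP yx]].
  have y0 : y != 0 by rewrite -sqrf_eq0 yx.
  by rewrite -yx -exprM mulnA expf_order.
apply: leq_trans card_squares_ge; rewrite cardE.
apply: max_unity_roots (enum_uniq _) => //.
by apply/allP => y; rewrite mem_enum inE => ?; apply/unity_rootP/eqP.
Qed.

Lemma card_quad_class e : #|quad_class e| = (2 * k)%N.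
Proof.
have cT : #|quad_class true| = (2 * k)%N.
  apply/eqP; rewrite eqn_leq card_squares_ge andbT cardE.
  apply: max_unity_roots (enum_uniq _); first by rewrite muln_gt0 k_gt0.
  by apply/allP => y; rewrite mem_enum euler_criterion => ?; apply/unity_rootP/eqP.
case: e => //.
have -> : quad_class false = [set x | x != 0] :\: quad_class true.
  by apply/setP => x; rewrite !inE eqb_id eqbF_neg; case: (x != 0); rewrite ?andbT.
have sub : quad_class true \subset [set x | x != 0].
  by apply/subsetP => x; rewrite !inE => /andP[].
by rewrite cardsDS // card_neq0 cT; lia.
Qed.

Lemma quad_classE e x : x != 0 ->
  (x \in quad_class e) = ((x ^+ (2 * k) == 1) == e).
Proof. by move=> x0; rewrite -euler_criterion !inE x0 eqb_id. Qed.

Lemma quad_class0 e : (0 \in quad_class e) = false.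
Proof. by rewrite inE eqxx. Qed.

(** As 2k is even, x and - x have the same image under Euler's power map.  This
    is where the congruence of the cardinal to 1 modulo 4 matters. *)
Lemma quad_classN e x : (- x \in quad_class e) = (x \in quad_class e).
Proof.
have [->|x0] := eqVneq x 0; first by rewrite oppr0.
by rewrite !quad_classE ?oppr_eq0 // exprM sqrrN -exprM.
Qed.

(** The power map x |-> x^(2k) takes only the values 1 and -1, so two elements
    of the same class have the same image. *)
Lemma quad_class_div (x y : F) : x != 0 -> y != 0 ->
  (x / y \in quad_class true) = ((x \in quad_class true) == (y \in quad_class true)).
Proof.
move=> x0 y0; rewrite !quad_classE ?mulf_neq0 ?invr_eq0 // !eqb_id.
have pm (z : F) : z != 0 -> (z ^+ (2 * k) == 1) || (z ^+ (2 * k) == -1).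
  move=> z0; rewrite -eqf_sqr -exprM expr1n.
  by rewrite mulnAC expf_order.
rewrite exprMn exprVn.
have yn : y ^+ (2 * k) != 0 by rewrite expf_neq0.
rewrite -(inj_eq (mulIf yn)) mulfVK // mul1r.
have [->|x1] /= := eqVneq (x ^+ (2 * k)) 1; first by rewrite [LHS]eq_sym; case: (_ == 1).
have [->|y1] := eqVneq (y ^+ (2 * k)) 1; first by rewrite (negPf x1).
have := pm _ x0; have := pm _ y0.
by rewrite (negPf x1) (negPf y1) => /= /eqP-> /eqP->; rewrite eqxx.
Qed.

Lemma sum_quad_class e : (\sum_x (x \in quad_class e) = 2 * k)%N.
Proof. by rewrite -(card_quad_class e) -sum1_card [RHS]big_mkcond. Qed.

(** * Cyclotomic numbers of order 2 *)

(** A sum of products of indicators rather than the cardinal of a set: the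
    counting identities then follow termwise, and the sum maps directly into
    any ring. *)
Definition cyclotomic (d : F) (e e' : bool) : nat :=
  (\sum_x (x \in quad_class e) * ((x + d)%R \in quad_class e'))%N.

Lemma quad_class_partition (x : F) :
  ((x \in quad_class true) + (x \in quad_class false) + (x == 0%R))%N = 1%N.
Proof. by rewrite !inE eqb_id eqbF_neg; case: eqP => // _; case: [exists y, _]. Qed.

Lemma quad_classF (x : F) : x != 0 ->
  (x \in quad_class false) = (x \notin quad_class true).
Proof. by move=> x0; rewrite !inE x0 eqb_id eqbF_neg. Qed.

(** Every x of class e has x + d in one of the two classes, except x = - d,
    which is itself of class e iff d is. *)
Lemma cyclotomic_row d e :
  (cyclotomic d e true + cyclotomic d e false + (d \in quad_class e) = 2 * k)%N.
Proof.
rewrite -(sum_quad_class e) -(quad_classN e d).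
have -> : nat_of_bool (- d \in quad_class e) =
    (\sum_x (x \in quad_class e) * ((x + d)%R == 0%R))%N.
  rewrite (bigD1 (- d)) //= addNr eqxx muln1 big1 ?addn0 // => x xd.
  by rewrite addr_eq0 (negPf xd) muln0.
rewrite -!big_split; apply: eq_bigr => x _ /=.
by rewrite -!mulnDr quad_class_partition muln1.
Qed.

(** Every x + d of class e has x in one of the two classes, except x = 0,
    for which x + d = d. *)
Lemma cyclotomic_col d e :
  (cyclotomic d true e + cyclotomic d false e + (d \in quad_class e) = 2 * k)%N.
Proof.
have -> : (2 * k = \sum_x ((x + d)%R \in quad_class e))%N.
  by rewrite -(sum_quad_class e) (reindex_inj (addIr d)).
have -> : nat_of_bool (d \in quad_class e) =
    (\sum_x (x == 0%R) * ((x + d)%R \in quad_class e))%N.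
  rewrite (bigD1 0) //= add0r eqxx mul1n big1 ?addn0 // => x x0.
  by rewrite (negPf x0).
rewrite -!big_split; apply: eq_bigr => x _ /=.
by rewrite -!mulnDl quad_class_partition mul1n.
Qed.

(** Nonzero x and x + d are of the same class iff 1 + d / x is a square, and
    1 + d / x takes each value other than 1 exactly once. *)
Lemma cyclotomic_diag d : d != 0 ->
  (cyclotomic d true true + cyclotomic d false false + 1 = 2 * k)%N.
Proof.
move=> d0; rewrite -(sum_quad_class true) (reindex_inj (addrI 1)) /=.
(* The value 0 of the shifted variable accounts for the term 1. *)
rewrite (bigD1 0) //= addr0 quad_classE ?oner_eq0 // expr1n eqxx addnC.
congr addn; rewrite (reindex_inj (inj_comp (mulfI d0) invr_inj)) /=.
rewrite [RHS]big_mkcond -big_split; apply: eq_bigr => x _ /=.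
rewrite mulf_eq0 (negPf d0) invr_eq0 /=.
have [->|x0] /= := eqVneq x 0; first by rewrite !quad_class0.
have [xd|xd0] := eqVneq (x + d) 0.
  rewrite xd !quad_class0 !muln0.
  move/eqP: xd; rewrite addrC addr_eq0 => /eqP->.
  by rewrite mulNr divff // subrr quad_class0.
rewrite -(divff x0) -mulrDl quad_class_div //.
have := quad_class_partition x; have := quad_class_partition (x + d).
rewrite (negPf x0) (negPf xd0).
by case: (x \in _); case: (x \in _); case: (_ \in _); case: (_ \in _).
Qed.

(** The row, column and diagonal identities form a linear system that determines
    the four cyclotomic numbers. *)
Lemma cyclotomicE d e e' : d != 0 ->
  (cyclotomic d e e' + ((e == e') && (d \in quad_class e)) = k)%N.
Proof.
move=> d0; have := quad_class_partition d; rewrite (negPf d0).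
have := cyclotomic_diag d0.
have := cyclotomic_row d true; have := cyclotomic_row d false.
have := cyclotomic_col d true; have := cyclotomic_col d false.
case: e; case: e' => /=; lia.
Qed.

Lemma cyclotomic0 e e' : cyclotomic 0 e e' = ((e == e') * (2 * k))%N.
Proof.
rewrite -(sum_quad_class e) big_distrr; apply: eq_bigr => x _ /=.
rewrite addr0; have := quad_class_partition x.
by case: e e' => [] []; case: (x \in _); case: (x \in _).
Qed.

(** * Correlation of functions constant on quadratic classes *)

Section Correlation.
Variable R : comNzRingType.

Definition quad_fun (a b c : R) (x : F) : R :=
  if x == 0 then a else if x \in quad_class true then b else c.

(** A linear combination of indicators, so that correlations expand
    bilinearly. *)
Lemma quad_funE a b c x : quad_fun a b c x =
  (x == 0)%:R * a + ((x \in quad_class true)%:R * b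
                     + (x \in quad_class false)%:R * c).
Proof.
rewrite /quad_fun; have [->|x0] := eqVneq x 0.
  by rewrite !quad_class0 /=; ring.
by rewrite quad_classF //; case: (x \in _) => /=; ring.
Qed.

Lemma quad_funN a b c x : quad_fun a b c (- x) = quad_fun a b c x.
Proof. by rewrite /quad_fun oppr_eq0 quad_classN. Qed.

Lemma sum_delta (G : F -> R) y : \sum_x (x == y)%:R * G x = G y.
Proof.
rewrite (bigD1 y) //= eqxx mul1r big1 ?addr0 // => x /negPf ->.
by rewrite mul0r.
Qed.

(** The products of indicators sum to cyclotomic numbers, and the terms
    at x = 0 and x = - d contribute a and a' times the value of the other
    function at d (once only, when d = 0). *)
Lemma quad_fun_correlation a b c a' b' c' d :
  \sum_x quad_fun a b c x * quad_fun a' b' c' (x + d) =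
  quad_fun (a * a' + (2 * k)%:R * (b * b' + c * c'))
    (a * b' + b * a' + (k%:R - 1) * (b * b') + k%:R * (b * c' + c * b')
      + k%:R * (c * c'))
    (a * c' + c * a' + k%:R * (b * b') + k%:R * (b * c' + c * b')
      + (k%:R - 1) * (c * c')) d.
Proof.
(* f0 is the first function with its value at 0 removed: otherwise, for d = 0,
   the term a * a' would be counted twice. *)
pose g := quad_fun a' b' c'; pose f0 := quad_fun 0 b c.
transitivity (a * g d + f0 d * a'
  + (cyclotomic d true true)%:R * (b * b')
  + (cyclotomic d true false)%:R * (b * c')
  + (cyclotomic d false true)%:R * (c * b')
  + (cyclotomic d false false)%:R * (c * c')).
  have -> : g d = \sum_x (x == 0)%:R * g (x + d).
    by rewrite (sum_delta (fun x => g (x + d))) add0r.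
  have -> : f0 d = \sum_x (x == - d)%:R * f0 x by rewrite sum_delta [RHS]quad_funN.
  rewrite !natr_sum !mulr_suml mulr_sumr -!big_split /=.
  apply: eq_bigr => x _.
  by rewrite /g /f0 !quad_funE !natrM addr_eq0; ring.
have [->|d0] := eqVneq d 0.
  by rewrite !cyclotomic0 /g /f0 /quad_fun eqxx /=; ring.
have K e e' : (cyclotomic d e e')%:R =
    k%:R - ((e == e') && (d \in quad_class e))%:R :> R.
  by rewrite -[in k%:R](cyclotomicE e e' d0) natrD addrK.
rewrite !K /g /f0 /quad_fun (negPf d0) /= quad_classF //.
by case: (d \in _) => /=; ring.
Qed.

End Correlation.

End Cyclotomic.

(** * Products of quadratic residue circulants *)

Section QuadraticCirculants.
Variables (R : comNzRingType) (p k : nat).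
Hypotheses (p_prime : prime p) (pE : p = (4 * k + 1)%N).

Lemma Fp_nat_eq m n : (m%:R == n%:R :> 'F_p) = (m == n %[mod p]).
Proof. by rewrite -val_eqE /= !val_Fp_nat. Qed.

Lemma cardFp : #|'F_p| = (4 * k + 1)%N.
Proof. by rewrite card_Fp. Qed.

Lemma ord_Fp_bij : bijective (fun i : 'I_p => (i : nat)%:R : 'F_p).
Proof.
apply: inj_card_bij; last by rewrite card_Fp // card_ord.
by move=> i j /eqP; rewrite Fp_nat_eq !modn_small // => /eqP /val_inj.
Qed.

Lemma quad_residueE m : ~~ (p %| m)%N ->
  quad_residue p m = (m%:R \in quad_class 'F_p true).
Proof.
rewrite /dvdn => pm; rewrite inE eqb_id -[0]/(0%:R) Fp_nat_eq mod0n pm /=.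
apply/existsP/existsP => [[x /eqP xm]|[y /eqP ym]].
  by exists x%:R; rewrite -natrX Fp_nat_eq xm.
have [x xy] : exists x : 'I_p, x%:R = y by have [g _ gK] := ord_Fp_bij; exists (g y).
by exists x; rewrite -Fp_nat_eq natrX xy ym.
Qed.

(** Entries depend only on the difference of indices in F_p, so matrix products
    become correlations over the field. *)
Lemma QpE a b c i j :
  Qp p a b c i j = quad_fun a b c (j%:R - i%:R : 'F_p) :> R.
Proof.
rewrite mxE /quad_fun.
set m := ((j + (p - i)) %% p)%N.
have <- : m%:R = j%:R - i%:R :> 'F_p.
  apply: (canRL (addrK _)); rewrite -natrD; apply/eqP.
  by rewrite Fp_nat_eq modnDml -addnA subnK ?modnDr // ltnW.
rewrite -[0]/(0%:R) Fp_nat_eq mod0n modn_mod.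
case: eqP => // /eqP m0.
by rewrite quad_residueE // /dvdn modn_mod.
Qed.

(** Entry (i, j) of the product is a correlation at i - j; the sign is absorbed
    by the symmetry of the resulting function. *)
Lemma Qp_mul_tr a b c a' b' c' :
  Qp p a b c *m (Qp p a' b' c')^T =
  Qp p (a * a' + (2 * k)%:R * (b * b' + c * c'))
    (a * b' + b * a' + (k%:R - 1) * (b * b') + k%:R * (b * c' + c * b')
      + k%:R * (c * c'))
    (a * c' + c * a' + k%:R * (b * b') + k%:R * (b * c' + c * b')
      + (k%:R - 1) * (c * c')) :> 'M[R]_p.
Proof.
apply/matrixP => i j; rewrite QpE -(quad_funN cardFp) opprB.
rewrite -(quad_fun_correlation cardFp) mxE (reindex_inj (addIr (- i%:R))) /=.
rewrite (reindex _ (onW_bij _ ord_Fp_bij)); apply: eq_bigr => l _ /=.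
by rewrite [_^T _ _]mxE !QpE addrA subrK.
Qed.

End QuadraticCirculants.

Lemma Qp_sum (R : nzRingType) (p : nat) (I : finType) (a b c : I -> R) :
  \sum_i Qp p (a i) (b i) (c i) = Qp p (\sum_i a i) (\sum_i b i) (\sum_i c i).
Proof.
apply/matrixP => i j; rewrite summxE mxE.
under eq_bigr do rewrite mxE.
by case: eqP => // _; case: quad_residue.
Qed.

(** * Self-orthogonality and block circulant matrices *)

(** The Gram matrix lists the inner products of the generators, and every inner
    product in the code is a bilinear combination of them. *)
Lemma self_orthogonal_row_code (R : finComNzRingType) (m n : nat)
    (M : 'M[R]_(m, n)) :
  self_orthogonal (row_code M) <-> M *m M^T = 0.
Proof.
have dot (x y : 'rV[R]_n) : \sum_i x 0 i * y 0 i = (x *m y^T) 0 0.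
  by rewrite mxE; apply: eq_bigr => i _; rewrite mxE.
split=> [/subsetP so | MM0].
  have in_code i : row i M \in row_code M by rewrite rowE; apply: imset_f.
  apply/matrixP => i j; have := so _ (in_code i).
  rewrite inE => /forall_inP/(_ _ (in_code j))/eqP; rewrite dot => ij0.
  by rewrite [RHS]mxE -ij0 !mxE; apply: eq_bigr => l _; rewrite !mxE.
apply/subsetP => _ /imsetP[u _ ->]; rewrite inE.
apply/forall_inP => _ /imsetP[v _ ->]; rewrite dot trmx_mul mulmxA.
by rewrite -(mulmxA u) MM0 mulmx0 mul0mx mxE.
Qed.

Section BlockCirculant.
Variables (R : comNzRingType) (p : nat).
Implicit Types X Y : 'I_3 -> 'M[R]_p.

Definition correlation X (s : 'I_3) : 'M[R]_p := \sum_i X i *m (X (i - s))^T.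

Lemma big_ord3 (V : nmodType) (G : 'I_3 -> V) : \sum_i G i = G 0 + G 1 + G 2.
Proof.
rewrite !big_ord_recr big_ord0 /= add0r.
by congr (G _ + G _ + G _); apply: val_inj.
Qed.

(** Block row r carries X_(j - r) in block column j, so rows r and r' have inner
    product sum_j X_(j - r) X_(j - r')^T, the correlation at r' - r. *)
Lemma block_circulant3_mul_tr X :
  block_circulant3 X *m (block_circulant3 X)^T = block_circulant3 (correlation X).
Proof.
have e01 : 0 - 1 = 2 :> 'I_3 by apply: val_inj.
have e02 : 0 - 2 = 1 :> 'I_3 by apply: val_inj.
have e12 : 1 - 2 = 2 :> 'I_3 by apply: val_inj.
have e21 : 2 - 1 = 1 :> 'I_3 by apply: val_inj.
rewrite /block_circulant3 !tr_col_mx !tr_row_mx.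
rewrite !mul_col_mx !mul_mx_row !mul_row_col.
rewrite /correlation !big_ord3 !subr0 !subrr e01 e02 e12 e21.
congr (col_mx (col_mx (row_mx (row_mx _ _) _) (row_mx (row_mx _ _) _))
              (row_mx (row_mx _ _) _)).
(* In block row r the three summands are rotated r times. *)
all: by rewrite // addrC addrA // addrC addrA.
Qed.

Lemma correlationN X s : correlation X (- s) = (correlation X s)^T.
Proof.
rewrite /correlation raddf_sum (reindex_inj (addIr (- s))) /=.
by apply: eq_bigr => i _; rewrite trmx_mul trmxK opprK subrK.
Qed.

Lemma block_circulant3D X Y :
  block_circulant3 X + block_circulant3 Y = block_circulant3 (fun i => X i + Y i).
Proof. by rewrite /block_circulant3 !add_col_mx !add_row_mx. Qed.

Lemma block_circulant3_eq0 X : block_circulant3 X = 0 <-> forall i, X i = 0.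
Proof.
split=> [|X0]; last by rewrite /block_circulant3 !X0 !row_mx0 !col_mx0.
rewrite /block_circulant3.
move/eqP; rewrite !(col_mx_eq0, row_mx_eq0).
move=> /andP[/andP[/andP[/andP[/eqP X0 /eqP X1] /eqP X2] _] _] i.
case: i => [[|[|[|//]]] lt_i3].
- by rewrite -[RHS]X0; congr X; apply: val_inj.
- by rewrite -[RHS]X1; congr X; apply: val_inj.
- by rewrite -[RHS]X2; congr X; apply: val_inj.
Qed.

End BlockCirculant.

Lemma addmx_eq0_pchar2 (R : nzRingType) m n (X Y : 'M[R]_(m, n)) :
  2%N \in [pchar R] -> X + Y = 0 <-> Y = X.
Proof.
move=> char2; have NX : - X = X by apply/matrixP => i j; rewrite mxE oppr_pchar2.
split=> [/eqP | ->]; first by rewrite addrC addr_eq0 NX => /eqP.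
by rewrite -{1}NX addNr.
Qed.

Lemma sub1_res3 (i : 'I_3) : i - 1 = res3 (i + 2).
Proof. by case: i => [[|[|[|//]]] ?]; apply: val_inj. Qed.

Theorem theorem4p1 (R : finComNzRingType) (p k : nat)
    (a b c : 'I_3 -> R) (A : 'I_3 -> 'M[R]_p)
    (hFrob : is_frobenius R) (hchar : 2%N \in [pchar R])
    (hp : prime p) (hpk : p = (4 * k + 1)%N)
    (hA : forall i, is_circulant (A i)) :
  let Q := fun i : 'I_3 => Qp p (a i) (b i) (c i) in
  let M : 'M[R]_(p + p + p, (p + p + p) + (p + p + p)) :=
    row_mx (block_circulant3 Q) (block_circulant3 A) in
  let alpha : R := \sum_(i < 3) a i * a (res3 (i + 2)) in
  let beta : R := \sum_(i < 3)
    (a i * b (res3 (i + 2)) + b i * a (res3 (i + 2))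
     + (k + 1)%:R * (b i * b (res3 (i + 2)))
     + k%:R * (b i * c (res3 (i + 2)) + c i * b (res3 (i + 2)))
     + k%:R * (c i * c (res3 (i + 2)))) in
  let gamma : R := \sum_(i < 3)
    (a i * c (res3 (i + 2)) + c i * a (res3 (i + 2))
     + k%:R * (b i * b (res3 (i + 2)))
     + k%:R * (b i * c (res3 (i + 2)) + c i * b (res3 (i + 2)))
     + (k + 1)%:R * (c i * c (res3 (i + 2)))) in
  self_orthogonal (row_code M) <->
  \sum_(i < 3) A i *m (A i)^T =
    Qp p (\sum_(i < 3) a i ^+ 2)
         (\sum_(i < 3) (b i ^+ 2 + k%:R * (b i ^+ 2 + c i ^+ 2)))
         (\sum_(i < 3) (c i ^+ 2 + k%:R * (b i ^+ 2 + c i ^+ 2)))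
  /\
  \sum_(i < 3) A i *m (A (res3 (i + 2)))^T = Qp p alpha beta gamma.
Proof.
move=> Q M alpha beta gamma.
have two0 : 2%:R = 0 :> R by apply: pcharf0.
have QQ0 : correlation Q 0 =
    Qp p (\sum_(i < 3) a i ^+ 2)
         (\sum_(i < 3) (b i ^+ 2 + k%:R * (b i ^+ 2 + c i ^+ 2)))
         (\sum_(i < 3) (c i ^+ 2 + k%:R * (b i ^+ 2 + c i ^+ 2))).
  rewrite /correlation -Qp_sum; apply: eq_bigr => i _.
  rewrite subr0 (Qp_mul_tr hp hpk); congr (Qp p _ _ _).
  (* Modulo 2 the cross terms of the symmetric products cancel. *)
  - by rewrite natrM two0; ring.
  - transitivity (b i ^+ 2 + k%:R * (b i ^+ 2 + c i ^+ 2) +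
      2%:R * (a i * b i - b i ^+ 2 + k%:R * (b i * c i))); first by ring.
    by rewrite two0 mul0r addr0.
  - transitivity (c i ^+ 2 + k%:R * (b i ^+ 2 + c i ^+ 2) +
      2%:R * (a i * c i - c i ^+ 2 + k%:R * (b i * c i))); first by ring.
    by rewrite two0 mul0r addr0.
have N1 : - 1 = 1 :> R by rewrite oppr_pchar2.
have QQ1 : correlation Q 1 = Qp p alpha beta gamma.
  rewrite /correlation -Qp_sum; apply: eq_bigr => i _.
  rewrite sub1_res3 (Qp_mul_tr hp hpk) N1 natrM two0 natrD.
  by congr (Qp p _ _ _); ring.
have AA1 : correlation A 1 = \sum_(i < 3) A i *m (A (res3 (i + 2)))^T.
  by apply: eq_bigr => i _; rewrite sub1_res3.
have AA0 : correlation A 0 = \sum_(i < 3) A i *m (A i)^T.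
  by apply: eq_bigr => i _; rewrite subr0.
rewrite self_orthogonal_row_code tr_row_mx mul_row_col.
rewrite !block_circulant3_mul_tr block_circulant3D block_circulant3_eq0.
rewrite -AA0 -AA1 -QQ0 -QQ1.
split=> [orth | [A0 A1] s].
  by split; apply/addmx_eq0_pchar2.
apply/(addmx_eq0_pchar2 _ _ hchar).
case: s => [[|[|[|//]]] lt_s3].
- by rewrite (_ : Ordinal _ = 0) //; apply: val_inj.
- by rewrite (_ : Ordinal _ = 1) //; apply: val_inj.
(* The condition at 2 = - 1 is the transpose of the one at 1. *)
- rewrite (_ : Ordinal _ = - 1); last exact: val_inj.
  by rewrite !correlationN A1.
Qed.
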